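(* Let $q\in(0,1)$. Then for every real $x>0$, $$\sqrt{[x]_q} \;\leq\; \frac{\Gamma_{q}(x+1)}{\Gamma_{q}\left(x+\frac{1}{2}\right)} \;\leq\; \sqrt{\left[x+\tfrac{1}{2}\right]_{q}}.$$
   Context: For $q\in(0,1)$ and real $x$, $[x]_q=\frac{1-q^x}{1-q}$. The $q$-deformed Gamma function is defined for $q\in(0,1)$ and $x>0$ by $$\Gamma_q(x)=(1-q)^{1-x}\prod_{n=0}^{\infty}\frac{1-q^{n+1}}{1-q^{n+x}},$$ equivalently by the Jackson integral $\Gamma_q(x)=\int_0^{1/(1-q)} t^{x-1}E_q^{-qt}\,d_qt$, where $\int_0^a f(t)\,d_qt=(1-q)a\sum_{n=0}^\infty f(aq^n)q^n$ and $E_q^{t}=\prod_{i=0}^{\infty}(1+(1-q)tq^i)$. *)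

(* Defs.v *)
From HB Require Import structures.
From mathcomp Require Import all_boot all_order all_algebra.
From mathcomp Require Import all_classical all_reals all_analysis.

Set Implicit Arguments.
Unset Strict Implicit.
Unset Printing Implicit Defensive.

Import Order.TTheory GRing.Theory Num.Theory.
Import numFieldNormedType.Exports.

Local Open Scope classical_set_scope.
Local Open Scope ring_scope.

Definition qnumber (R : realType) (q x : R) : R := (1 - q `^ x) / (1 - q).

(* The infinite product is the limit of its partial products. [lim] is total,
   so the value is meaningful only when these converge, as they do for
   0 < q < 1 and 0 < x. *)
Definition qGamma (R : realType) (q x : R) : R :=
  (1 - q) `^ (1 - x) *
  limn (fun N : nat =>
    \prod_(0 <= n < N) ((1 - q ^+ n.+1) / (1 - q `^ (n%:R + x)))).

(* Main.v *)
(** Gamma_q satisfies the functional equation Gamma_q(x + 1) = [x]_q Gamma_q(x)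
    and is midpoint log-convex, Gamma_q(x + 1/2)^2 <= Gamma_q(x) Gamma_q(x + 1).
    For the partial products the first holds up to a factor 1 - q^(N + x),
    which tends to 1, and the second holds factor by factor.
    Log-convexity at x and at x + 1/2, combined with the functional equation,
    gives the lower and the upper bound respectively. *)

Require Import Defs.
From HB Require Import structures.
From mathcomp Require Import all_boot all_order all_algebra.
From mathcomp Require Import all_classical all_reals all_analysis.
From mathcomp Require Import ring lra.

Set Implicit Arguments.
Unset Strict Implicit.
Unset Printing Implicit Defensive.

Import Order.TTheory GRing.Theory Num.Theory.
Import numFieldNormedType.Exports.

Local Open Scope classical_set_scope.
Local Open Scope ring_scope.

Definition qGamma_prod (R : realType) (q x : R) (N : nat) : R :=
  \prod_(0 <= n < N) ((1 - q ^+ n.+1) / (1 - q `^ (n%:R + x))).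

Section qGamma_theory.
Context {R : realType} (q : R).
Hypotheses (q_gt0 : 0 < q) (q_lt1 : q < 1).
Implicit Types x : R.

Lemma powR_lt1 x : 0 < x -> q `^ x < 1.
Proof.
move=> x0; rewrite /powR gt_eqF// expR_lt1 pmulr_rlt0//.
by rewrite ln_lt0// q_gt0.
Qed.

Lemma subr_powR_gt0 x (n : nat) : 0 < x -> 0 < 1 - q `^ (n%:R + x).
Proof. by move=> x0; rewrite subr_gt0 powR_lt1// ltr_wpDl. Qed.

Lemma subr_exprS_gt0 (n : nat) : 0 < 1 - q ^+ n.+1.
Proof. by rewrite subr_gt0 exprn_ilt1// ltW. Qed.

Lemma qGamma_factor_gt0 x (n : nat) : 0 < x ->
  0 < (1 - q ^+ n.+1) / (1 - q `^ (n%:R + x)).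
Proof. by move=> x0; rewrite divr_gt0// ?subr_exprS_gt0// subr_powR_gt0. Qed.

Lemma qGamma_prodS x (N : nat) : qGamma_prod q x N.+1 =
  qGamma_prod q x N * ((1 - q ^+ N.+1) / (1 - q `^ (N%:R + x))).
Proof. by rewrite /qGamma_prod big_nat_recr. Qed.

Lemma qGamma_prod_gt0 x (N : nat) : 0 < x -> 0 < qGamma_prod q x N.
Proof. by move=> x0; apply: prodr_gt0 => n _; exact: qGamma_factor_gt0. Qed.

(** Telescoping: raising [x] by 1 shifts the denominators by one index, so only the first and the
    last of them survive in the quotient. *)
Lemma qGamma_prodD1 x (N : nat) : 0 < x ->
  qGamma_prod q (x + 1) N * (1 - q `^ (N%:R + x)) =
  (1 - q `^ x) * qGamma_prod q x N.
Proof.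
move=> x0; elim: N => [|N IH].
  by rewrite /qGamma_prod !big_nil add0r mul1r mulr1.
have E : N%:R + (x + 1) = N.+1%:R + x by rewrite -natr1; ring.
have h0 := lt0r_neq0 (subr_powR_gt0 N x0).
have h1 := lt0r_neq0 (subr_powR_gt0 N.+1 x0).
rewrite !qGamma_prodS E [RHS]mulrA -IH.
by field; rewrite h0 h1.
Qed.

(** The numerators agree, so only denominators are compared. With [t = q^(n+x)] and [s = q^(1/2)],
    their difference is [t * (1 - s)^2]. *)
Lemma qGamma_factor_logconvex x (n : nat) : 0 < x ->
  ((1 - q ^+ n.+1) / (1 - q `^ (n%:R + (x + 1 / 2)))) ^+ 2 <=
  (1 - q ^+ n.+1) / (1 - q `^ (n%:R + x)) *
  ((1 - q ^+ n.+1) / (1 - q `^ (n%:R + (x + 1)))).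
Proof.
move=> x0.
have h0 := subr_powR_gt0 n x0.
have h1 : 0 < 1 - q `^ (n%:R + (x + 1 / 2)) by apply: subr_powR_gt0; lra.
have h2 : 0 < 1 - q `^ (n%:R + (x + 1)) by apply: subr_powR_gt0; lra.
rewrite mulrACA -invfM -expr2 exprMn exprVn ler_wpM2l ?sqr_ge0//.
rewrite lef_pV2 ?posrE ?mulr_gt0 ?exprn_gt0//.
have E1 : q `^ (n%:R + (x + 1 / 2)) = q `^ (n%:R + x) * q `^ (1 / 2).
  by rewrite -powRD ?(gt_eqF q_gt0) ?implybT// addrA.
have E2 : q `^ (n%:R + (x + 1)) = q `^ (n%:R + x) * q `^ (1 / 2) ^+ 2.
  rewrite expr2 -!powRD ?(gt_eqF q_gt0) ?implybT//; congr (_ `^ _).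
  by field.
rewrite E1 E2 -subr_ge0.
set t := q `^ (n%:R + x); set s := q `^ (1 / 2).
have -> : (1 - t * s) ^+ 2 - (1 - t) * (1 - t * s ^+ 2) = t * (1 - s) ^+ 2.
  ring.
by rewrite mulr_ge0 ?powR_ge0 ?sqr_ge0.
Qed.

Lemma qGamma_prod_logconvex x (N : nat) : 0 < x ->
  qGamma_prod q (x + 1 / 2) N ^+ 2 <=
  qGamma_prod q x N * qGamma_prod q (x + 1) N.
Proof.
move=> x0; rewrite /qGamma_prod -prodrXl -big_split /=.
apply: ler_prod => n _.
by rewrite sqr_ge0 qGamma_factor_logconvex.
Qed.

(** Powers of [q] decrease in the exponent, so comparing [n + x] with [n + 1] decides on which side
    of 1 the factor lies. This makes the partial products monotone in [N]. *)
Lemma qGamma_factor_ge1 x (n : nat) : 0 < x -> x <= 1 ->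
  1 <= (1 - q ^+ n.+1) / (1 - q `^ (n%:R + x)).
Proof.
move=> x0 x1; rewrite ler_pdivlMr ?subr_powR_gt0// mul1r lerB//.
by rewrite -powR_mulrn ?(ltW q_gt0)// ger_powR ?q_gt0 ?(ltW q_lt1)// -natr1 lerD2l.
Qed.

Lemma qGamma_factor_le1 x (n : nat) : 1 <= x ->
  (1 - q ^+ n.+1) / (1 - q `^ (n%:R + x)) <= 1.
Proof.
move=> x1; have x0 : 0 < x by rewrite (lt_le_trans _ x1).
rewrite ler_pdivrMr ?subr_powR_gt0// mul1r lerB//.
by rewrite -powR_mulrn ?(ltW q_gt0)// ger_powR ?q_gt0 ?(ltW q_lt1)// -natr1 lerD2l.
Qed.

Lemma qGamma_prod_ge1 x (N : nat) : 0 < x -> x <= 1 -> 1 <= qGamma_prod q x N.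
Proof.
move=> x0 x1; elim: N => [|N IH]; first by rewrite /qGamma_prod big_nil.
by rewrite qGamma_prodS mulr_ege1// qGamma_factor_ge1.
Qed.

Lemma qGamma_prod_le1 x (N : nat) : 1 <= x -> qGamma_prod q x N <= 1.
Proof.
move=> x1; have x0 : 0 < x by rewrite (lt_le_trans _ x1).
elim: N => [|N IH]; first by rewrite /qGamma_prod big_nil.
by rewrite qGamma_prodS mulr_ile1// ?qGamma_factor_le1// ltW//
  ?qGamma_prod_gt0// qGamma_factor_gt0.
Qed.

(** By [qGamma_prodD1], [1 - q^x] times the product at [x] is the product at [x + 1], which is at
    most 1, times a factor at most 1. *)
Lemma qGamma_prod_ub x (N : nat) : 0 < x ->
  qGamma_prod q x N <= (1 - q `^ x)^-1.
Proof.
move=> x0; have h : 0 < 1 - q `^ x by rewrite subr_gt0 powR_lt1.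
rewrite -[leRHS]mulr1 ler_pdivlMl// -qGamma_prodD1//.
apply: mulr_ile1; rewrite ?(ltW (subr_powR_gt0 _ _))//.
- by rewrite ltW// qGamma_prod_gt0// addr_gt0.
- by rewrite qGamma_prod_le1// lerDr ltW.
- by rewrite gerBl powR_ge0.
Qed.

(** A bound uniform in [N] keeps the limit away from 0. Induction on an integer above [x] descends
    by [qGamma_prodD1] to [x <= 1], where 1 is a bound. *)
Lemma qGamma_prod_lb x : 0 < x ->
  exists2 c, 0 < c & forall N, c <= qGamma_prod q x N.
Proof.
move=> x0; have [k] : exists k : nat, x <= k.+1%:R.
  by exists (Num.truncn x); rewrite ltW// truncnS_gt.
elim: k x x0 => [|k IH] x x0 xk.
  by exists 1 => // N; exact: qGamma_prod_ge1.
have [x1|x1] := leP x 1; first by exists 1 => // N; exact: qGamma_prod_ge1.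
have y0 : 0 < x - 1 by rewrite subr_gt0.
have [c c0 cP] : exists2 c, 0 < c & forall N, c <= qGamma_prod q (x - 1) N.
  by apply: IH => //; rewrite lerBlDr natr1.
have h : 0 < 1 - q `^ (x - 1) by rewrite subr_gt0 powR_lt1.
exists ((1 - q `^ (x - 1)) * c) => [|N]; first exact: mulr_gt0.
apply: (le_trans (ler_wpM2l (ltW h) (cP N))).
rewrite -qGamma_prodD1// subrK ler_piMr//; first by rewrite ltW// qGamma_prod_gt0.
by rewrite gerBl powR_ge0.
Qed.

Lemma is_cvg_qGamma_prod x : 0 < x -> cvgn (qGamma_prod q x).
Proof.
move=> x0; have [x1|x1] := leP x 1.
- apply: nondecreasing_is_cvgn.
    apply/nondecreasing_seqP => N.
    by rewrite qGamma_prodS ler_peMr ?qGamma_factor_ge1// ltW// qGamma_prod_gt0.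
  by exists (1 - q `^ x)^-1 => _ [N _ <-]; exact: qGamma_prod_ub.
- apply: nonincreasing_is_cvgn.
    apply/nonincreasing_seqP => N.
    rewrite qGamma_prodS ler_piMr ?qGamma_factor_le1// ltW//.
    exact: qGamma_prod_gt0.
  by exists 0 => _ [N _ <-]; rewrite ltW// qGamma_prod_gt0.
Qed.

Lemma qGamma_gt0 x : 0 < x -> 0 < qGamma q x.
Proof.
move=> x0; rewrite mulr_gt0 ?powR_gt0 ?subr_gt0//.
have [c c0 cP] := qGamma_prod_lb x0.
apply: (lt_le_trans c0); apply: limr_ge; first exact: is_cvg_qGamma_prod.
exact: nearW.
Qed.

Lemma cvg_subr_powR x : (fun N : nat => 1 - q `^ (N%:R + x)) @ \oo --> (1 : R).
Proof.
rewrite -[X in _ --> X]subr0; apply: cvgB; first exact: cvg_cst.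
rewrite -(mul0r (q `^ x)).
under eq_fun do rewrite powRD ?(gt_eqF q_gt0) ?implybT// powR_mulrn ?ltW//.
by apply: cvgMr_tmp; apply: cvg_expr; rewrite gtr0_norm.
Qed.

Lemma qGammaD1 x : 0 < x -> qGamma q (x + 1) = qnumber q x * qGamma q x.
Proof.
move=> x0; have x10 : 0 < x + 1 by rewrite addr_gt0.
(* Pass to the limit in [qGamma_prodD1]. *)
have E : limn (qGamma_prod q (x + 1)) = (1 - q `^ x) * limn (qGamma_prod q x).
  have : (fun N => qGamma_prod q (x + 1) N * (1 - q `^ (N%:R + x))) @ \oo -->
      limn (qGamma_prod q (x + 1)) * 1.
    by apply: cvgM (cvg_subr_powR x); exact: is_cvg_qGamma_prod.
  under eq_fun do rewrite qGamma_prodD1//.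
  move=> /(cvg_lim (@norm_hausdorff _ _)); rewrite mulr1 => <-.
  rewrite limM ?(lim_cst (@norm_hausdorff _ _))//; first exact: cvg_cst.
  exact: is_cvg_qGamma_prod.
have q1 : 0 < 1 - q by rewrite subr_gt0.
have -> : qGamma q (x + 1) = (1 - q) `^ (1 - (x + 1)) *
  limn (qGamma_prod q (x + 1)) by [].
have -> : qGamma q x = (1 - q) `^ (1 - x) * limn (qGamma_prod q x) by [].
(* The extra factor [1 - q] split off here cancels the denominator of [qnumber q x]. *)
have -> : 1 - x = (1 - (x + 1)) + 1 by ring.
move: (1 - (x + 1)) => y.
rewrite E powRD ?(gt_eqF q1) ?implybT// powRr1 ?ltW// /qnumber.
by field; rewrite gt_eqF.
Qed.

(** The exponent [1 - x] is affine in [x], so the powers of [1 - q] on both sides coincide; the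
    inequality of partial products passes to the limit. *)
Lemma qGamma_logconvex x : 0 < x ->
  qGamma q (x + 1 / 2) ^+ 2 <= qGamma q x * qGamma q (x + 1).
Proof.
move=> x0.
have x10 : 0 < x + 1 by lra.
have x20 : 0 < x + 1 / 2 by lra.
have q1 : 0 < 1 - q by rewrite subr_gt0.
rewrite exprMn [leRHS]mulrACA [X in X * _ <= _]expr2.
rewrite -!powRD ?(gt_eqF q1) ?implybT//.
have -> : 1 - (x + 1 / 2) + (1 - (x + 1 / 2)) = 1 - x + (1 - (x + 1)).
  by field.
rewrite ler_wpM2l ?powR_ge0// expr2 -!limM; try exact: is_cvg_qGamma_prod.
apply: ler_lim; try by apply: is_cvgM; exact: is_cvg_qGamma_prod.
by apply: nearW => N; rewrite /= -expr2; exact: qGamma_prod_logconvex.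
Qed.

End qGamma_theory.

Theorem theorem2p2 (R : realType) (q : R) (q_gt0 : 0 < q) (q_lt1 : q < 1)
    (x : R) (x_gt0 : 0 < x) :
  Num.sqrt (qnumber q x) <= qGamma q (x + 1) / qGamma q (x + 1 / 2)
    <= Num.sqrt (qnumber q (x + 1 / 2)).
Proof.
have x10 : 0 < x + 1 by lra.
have x20 : 0 < x + 1 / 2 by lra.
have g1 := qGamma_gt0 q_gt0 q_lt1 x10.
have g2 := qGamma_gt0 q_gt0 q_lt1 x20.
(* The positive ratio is the root of its square, so it suffices to compare squares. *)
rewrite -[X in _ <= X <= _](ger0_norm (ltW (divr_gt0 g1 g2))) -sqrtr_sqr.
have n0 : 0 <= qnumber q x.
  by rewrite divr_ge0 ?subr_ge0 ?(ltW q_lt1) ?(ltW (powR_lt1 _ _ _)).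
apply/andP; split; apply: ler_wsqrtr; rewrite expr_div_n.
(* Multiply log-convexity at [x] by [[x]_q] and absorb [[x]_q] into [Gamma_q(x)]. *)
- rewrite ler_pdivlMr ?exprn_gt0//.
  apply: (le_trans (ler_wpM2l n0 (qGamma_logconvex q_gt0 q_lt1 x_gt0))).
  by rewrite mulrA -qGammaD1// expr2.
(* Here [[x + 1/2]_q * Gamma_q(x + 1/2)] becomes [Gamma_q(x + 3/2)], leaving log-convexity at
   [x + 1/2]. *)
- rewrite ler_pdivrMr ?exprn_gt0// [X in _ <= _ * X]expr2 mulrA -qGammaD1//.
  have := qGamma_logconvex q_gt0 q_lt1 x20.
  have -> : x + 1 / 2 + 1 / 2 = x + 1 by field.
  by rewrite [leRHS]mulrC.
Qed.
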